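(* Let $t\geqslant3$ be an integer, and let $P,Q\in\mathbb Z_2[w_2,w_3,w_4]$ be polynomials such that in $H^*(\widetilde G_{2^t,4})$ one has $$\widetilde a_{2^t-4}^2=P(\widetilde w_2,\widetilde w_3,\widetilde w_4)\,\widetilde a_{2^t-4}+Q(\widetilde w_2,\widetilde w_3,\widetilde w_4).$$ Let $I$ be the ideal $\left(g_{2^t-2},g_{2^t-1},g_{2^t},a_{2^t-4}^2+Pa_{2^t-4}+Q\right)$ of $\mathbb Z_2[w_2,w_3,w_4,a_{2^t-4}]$. Then the set $$G=\{g_{2^t-3+2^i}\mid 0\leqslant i\leqslant t-1\}\cup\{g_{2^t},\;a_{2^t-4}^2+Pa_{2^t-4}+Q\}$$ is a Gröbner basis for $I$ with respect to the lexicographic monomial ordering in which $w_3\prec w_2\prec w_4\prec a_{2^t-4}$.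
   Context: $H^*(-)$ denotes cohomology with $\mathbb Z_2$ coefficients. $\widetilde G_{n,k}$ (resp. $G_{n,k}$) is the Grassmann manifold of oriented (resp. unoriented) $k$-dimensional subspaces of $\mathbb R^n$, and $p:\widetilde G_{2^t,4}\to G_{2^t,4}$ is the double cover forgetting the orientation. $\widetilde w_i=w_i(\widetilde\gamma_{2^t,4})$, $i=2,3,4$, are the Stiefel--Whitney classes of the canonical oriented bundle over $\widetilde G_{2^t,4}$. The polynomials $g_r\in\mathbb Z_2[w_2,w_3,w_4]$ are defined by $g_{-3}=g_{-2}=g_{-1}=0$, $g_0=1$ and $g_r=w_2g_{r-2}+w_3g_{r-3}+w_4g_{r-4}$ for $r\geqslant1$. The class $\widetilde a_{2^t-4}$: let $W_{3,1}^{2^t}=\{(U,v)\in\widetilde G_{2^t,3}\times S^{2^t-1}\mid v\perp U\}$, with the sphere bundle $S^{2^t-4}\xrightarrow{i}W_{3,1}^{2^t}\xrightarrow{p_1}\widetilde G_{2^t,3}$ ($p_1$ is the first projection) and the map $sp:W_{3,1}^{2^t}\to\widetilde G_{2^t,4}$ sending $(U,v)$ to the oriented 4-dimensional subspace spanned by $U$ and $v$. Fix a class $c_{2^t-4}\in H^{2^t-4}(W_{3,1}^{2^t})$ such that $i^*(c_{2^t-4})$ is the generator of $H^{2^t-4}(S^{2^t-4})$ (such a class exists). Then $\widetilde a_{2^t-4}$ is a fixed class in $H^{2^t-4}(\widetilde G_{2^t,4})\setminus\operatorname{im}p^*$ with $sp^*(\widetilde a_{2^t-4})=c_{2^t-4}$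 (such a class exists). Definition: a finite set $G$ of nonzero polynomials contained in an ideal $I$ of a polynomial ring over $\mathbb Z_2$ is a Gröbner basis for $I$ with respect to a monomial ordering if the cosets of the monomials not divisible by the leading monomial $\mathrm{LM}(f)$ of any $f\in G$ form a vector space basis of the quotient of the polynomial ring by $I$. *)

(* Defs.v *)
From HB Require Import structures.
From mathcomp Require Import all_boot all_order all_algebra.
From mathcomp Require Import generic_quotient ring_quotient.
From mathcomp Require Import all_classical reals topology.
From mathcomp Require Import mpoly.
(* normedtype is only used qualified: importing it together with mpoly makes
   their notation levels clash. *)
From mathcomp Require normedtype.
Import numFieldTopology.Exports normed_module.numFieldNormedType.Exports.

Set Implicit Arguments.
Unset Strict Implicit.
Unset Printing Implicit Defensive.
Import Order.TTheory GRing.Theory Num.Theory.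
Local Open Scope classical_set_scope.
Local Open Scope ring_scope.

Lemma coord_continuous (T : topologicalType) m n (i : 'I_m) (j : 'I_n) :
  continuous (fun M : 'M[T]_(m, n) => M i j).
Proof.
move=> M A /= MA.
pose P i' j' := if (i' == i) && (j' == j) then A else setT.
exists P.
  by move=> i' j'; rewrite /P; case: eqP => [->|_]; case: eqP => [->|_] //=; apply: filterT.
by move=> N /(_ i j); rewrite /P !eqxx.
Qed.

Lemma entry_continuous (X T : topologicalType) m n (f : X -> 'M[T]_(m, n)) i j :
  continuous f -> continuous (fun x => f x i j).
Proof.
move=> cf x; apply: (continuous_comp (g := fun M : 'M[T]_(m, n) => M i j)).
  exact: cf.
exact: coord_continuous.
Qed.

Lemma mx_continuous (X T : topologicalType) m n (f : X -> 'M[T]_(m, n)) :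
  (forall i j, continuous (fun x => f x i j)) -> continuous f.
Proof.
move=> cf x A [P PM sPA]; apply: (@filterS _ (nbhs x) _ (fun y => forall i j, P i j (f y i j))).
  by move=> y; apply: sPA.
apply: filter_forall => i; apply: filter_forall => j.
exact: (cf i j x _ (PM i j)).
Qed.

Lemma sum_continuous (R : realType) (X : topologicalType) (I : Type) (r : seq I)
    (F : I -> X -> R) :
  (forall i, continuous (F i)) -> continuous (fun x => \sum_(i <- r) F i x).
Proof.
move=> cF; elim: r => [|i r IH].
  by rewrite (_ : (fun x => _) = cst 0) => [x|]; [exact: cvg_cst|apply/funext => x; rewrite big_nil].
rewrite (_ : (fun x => _) = (fun x => F i x) \+ (fun x => \sum_(j <- r) F j x)); last first.
  by apply/funext => x; rewrite big_cons.
by move=> x; exact: (pseudometric_normed_Zmodule.cvgD (cF i x) (IH x)).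
Qed.

Lemma mulmx_continuous (R : realType) (X : topologicalType) m n p
    (f : X -> 'M[R]_(m, n)) (A : 'M[R]_(n, p)) :
  continuous f -> continuous (fun x => f x *m A).
Proof.
move=> cf; apply: mx_continuous => i j.
rewrite (_ : (fun x => _) = (fun x => \sum_k f x i k * A k j)); last by apply/funext => x; rewrite mxE.
apply: sum_continuous => k x.
apply: normed_module.cvgMr_tmp.
exact: entry_continuous.
Qed.

Lemma mulmxl_continuous (R : realType) (X : topologicalType) m n p
    (f : X -> 'M[R]_(m, n)) (A : 'M[R]_(p, m)) :
  continuous f -> continuous (fun x => A *m f x).
Proof.
move=> cf; apply: mx_continuous => i j.
rewrite (_ : (fun x => _) = (fun x => \sum_k A i k * f x k j)); last by apply/funext => x; rewrite mxE.
apply: sum_continuous => k x.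
apply: normed_module.cvgMl_tmp.
exact: entry_continuous.
Qed.

Section SingularSimplices.
Variable R : realType.

Definition std_simplex n : set 'rV[R]_n.+1 :=
  [set x | (forall i, 0 <= x 0 i) /\ \sum_i x 0 i = 1].
Arguments std_simplex : clear implicits.

(* Matrix of the affine map between standard simplices that sends the i-th
   vertex to the (phi i)-th one; points are row vectors of barycentric
   coordinates. *)
Definition vertex_mx m n (phi : 'I_m.+1 -> 'I_n.+1) : 'M[R]_(m.+1, n.+1) :=
  \matrix_(i, j) (phi i == j)%:R.

Lemma vertex_mx_simplex m n (phi : 'I_m.+1 -> 'I_n.+1) x :
  std_simplex m x -> std_simplex n (x *m vertex_mx phi).
Proof.
move=> [x_ge0 x1]; split=> [i|].
  by rewrite mxE sumr_ge0 // => k _; rewrite mxE mulr_ge0 ?ler0n.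
rewrite -x1.
under eq_bigr do rewrite mxE.
rewrite exchange_big /=; apply: eq_bigr => k _.
rewrite -mulr_sumr (bigD1 (phi k)) //= mxE eqxx big1 ?addr0 ?mulr1 // => j jk.
by rewrite mxE eq_sym (negbTE jk).
Qed.

Definition simplex_map m n (phi : 'I_m.+1 -> 'I_n.+1) (x : std_simplex m) :
    std_simplex n :=
  SigSub (mem_set (vertex_mx_simplex phi (set_valP x))).

Lemma simplex_map_continuous m n (phi : 'I_m.+1 -> 'I_n.+1) :
  continuous (simplex_map phi).
Proof.
apply: (@continuous_comp_initial _ _ _ set_val (simplex_map phi) _).
apply: (@mulmx_continuous R _ _ _ _ (fun x : std_simplex m => set_val x)).
exact: initial_continuous.
Qed.

Lemma simplex_map_comp m n p (phi : 'I_n.+1 -> 'I_p.+1) (psi : 'I_m.+1 -> 'I_n.+1) x :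
  simplex_map phi (simplex_map psi x) = simplex_map (phi \o psi) x.
Proof.
apply: val_inj => /=; rewrite -mulmxA; congr (_ *m _).
apply/matrixP => i j; rewrite !mxE (bigD1 (psi i)) //= !mxE eqxx mul1r.
rewrite big1 ?addr0 // => k kpsi; rewrite mxE eq_sym (negbTE kpsi) mul0r //.
Qed.

Definition singular (X : topologicalType) n : Type :=
  continuousType (std_simplex n) X.

Variable X : topologicalType.

(* The singular m-simplex [v_(phi 0), ..., v_(phi m)] of s = [v_0, ..., v_n]. It
   is only used for phi with values <= n on 0, ..., m: phi = bump i gives the
   i-th face, phi = addn a the face [v_a, ..., v_(a + m)]. *)
Definition subsimplex n (s : singular X n) m (phi : nat -> nat) : singular X m :=
  s \o mkcts (@simplex_map_continuous _ _ (fun k : 'I_m.+1 => inord (phi k) : 'I_n.+1)).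

Lemma eq_subsimplex n (s : singular X n) m f g :
  (forall k, (k <= m)%N -> f k = g k) -> subsimplex s m f = subsimplex s m g.
Proof.
move=> fg; rewrite /subsimplex.
congr (_ \o mkcts (@simplex_map_continuous _ _ _)).
by apply/funext => k; rewrite fg // -ltnS.
Qed.

Lemma subsimplex_comp n (s : singular X n) l m f g :
  (forall k, (k <= m)%N -> (g k <= l)%N) ->
  subsimplex (subsimplex s l f) m g = subsimplex s m (f \o g).
Proof.
move=> gl; apply/continuousEP => x; rewrite /subsimplex /= /mkcts.
rewrite simplex_map_comp; congr (s (simplex_map _ _)).
by apply/funext => k /=; rewrite inordK // ltnS gl // -ltnS.
Qed.

Lemma subsimplex_id n (s : singular X n) f :
  (forall k, (k <= n)%N -> f k = k) -> subsimplex s n f = s.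
Proof.
move=> fk; apply/continuousEP => x; rewrite /subsimplex /= /mkcts.
congr (s _); apply: val_inj => /=.
rewrite -[RHS]mulmx1; congr (_ *m _); apply/matrixP => i j.
by rewrite !mxE fk -1?ltnS // inord_val.
Qed.

(* Singular cochains with coefficients in Z/2, of all degrees at once: f n is
   the component of degree n. *)
Definition cochain : Type := forall n, singular X n -> 'F_2.

Implicit Types f g h : cochain.

HB.instance Definition _ := gen_eqMixin cochain.
HB.instance Definition _ := gen_choiceMixin cochain.

Lemma cochainP f g : (forall n s, f n s = g n s) -> f = g.
Proof. by move=> fg; apply: functional_extensionality_dep => n; apply/funext. Qed.

Definition caddr f g : cochain := fun n s => f n s + g n s.
Definition coppr f : cochain := fun n s => - f n s.
Definition czero : cochain := fun n s => 0.

Fact caddrA : associative caddr.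
Proof. by move=> f g h; apply: cochainP => n s; exact: addrA. Qed.
Fact caddrC : commutative caddr.
Proof. by move=> f g; apply: cochainP => n s; exact: addrC. Qed.
Fact cadd0r : left_id czero caddr.
Proof. by move=> f; apply: cochainP => n s; exact: add0r. Qed.
Fact caddNr : left_inverse czero coppr caddr.
Proof. by move=> f; apply: cochainP => n s; exact: addNr. Qed.
HB.instance Definition _ := GRing.isZmodule.Build cochain caddrA caddrC cadd0r caddNr.

Lemma caddE f g n s : (f + g) n s = f n s + g n s. Proof. by []. Qed.
Lemma coppE f n s : (- f) n s = - f n s. Proof. by []. Qed.

(* Cup product: the i-th term is f on the front i-face times g on the back
   (n - i)-face. *)
Definition cup f g : cochain := fun n s =>
  \sum_(i < n.+1) f i (subsimplex s i (addn 0)) * g (n - i)%N (subsimplex s (n - i) (addn i)).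

Definition cone : cochain := fun n s => if n is 0 then 1 else 0.

Definition coboundary f : cochain := fun n =>
  if n is m.+1 return singular X n -> 'F_2
  then fun s => \sum_(i < m.+2) f m (subsimplex s m (bump i))
  else fun=> 0.

Lemma sum_triangle (V : zmodType) n (T : nat -> nat -> V) :
  \sum_(i < n.+1) \sum_(j < i.+1) T i j =
  \sum_(j < n.+1) \sum_(k < (n - j).+1) T (j + k)%N j.
Proof.
elim: n => [|n IH]; first by rewrite !big_ord1.
rewrite big_ord_recr IH /= [RHS]big_ord_recr /= subnn big_ord1 addn0.
rewrite [X in _ + X = _]big_ord_recr /= addrA; congr (_ + _).
rewrite -big_split; apply: eq_bigr => j _ /=.
have jn : (j <= n)%N by rewrite -ltnS.
by rewrite subSn // [RHS]big_ord_recr /= addnS subnKC.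
Qed.

Fact cupA : associative cup.
Proof.
move=> f g h; apply: cochainP => n s.
pose F l := f l (subsimplex s l (addn 0)).
pose G a l := g l (subsimplex s l (addn a)).
pose H a l := h l (subsimplex s l (addn a)).
transitivity (\sum_(i < n.+1) \sum_(j < i.+1) F j * G j (i - j)%N * H i (n - i)%N).
  rewrite (sum_triangle _ (fun i j => F j * G j (i - j)%N * H i (n - i)%N)).
  apply: eq_bigr => j _; rewrite /cup mulr_sumr; apply: eq_bigr => k _.
  rewrite mulrA addKn; congr (_ * _ * _).
    rewrite /G subsimplex_comp; last by move=> i ik; rewrite add0n (leq_trans ik) // -ltnS.
    by congr (g _ _); apply: eq_subsimplex.
  rewrite /H subnDA subsimplex_comp.
    by congr (h _ _); apply: eq_subsimplex => i _ /=; rewrite addnA.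
  move=> i ik; rewrite -[X in (_ <= X)%N](@subnKC k) ?leq_add2l //.
  by rewrite -ltnS.
apply: eq_bigr => i _; rewrite /cup mulr_suml; apply: eq_bigr => j _.
have ji : (j <= i)%N by rewrite -ltnS.
congr (_ * _ * _).
  rewrite subsimplex_comp => [|k kj]; last by rewrite add0n (leq_trans kj).
  by congr (f _ _); apply: eq_subsimplex.
rewrite subsimplex_comp => [|k kj].
  by congr (g _ _); apply: eq_subsimplex.
by rewrite -[X in (_ <= X)%N](subnKC ji) leq_add2l.
Qed.

Fact cup1r : left_id cone cup.
Proof.
move=> f; apply: cochainP => n s; rewrite /cup big_ord_recl /= mul1r.
rewrite big1 ?addr0 => [|i _]; last by rewrite mul0r.
suff cs m : m = n -> f m (subsimplex s m (addn 0)) = f n s by exact/cs/subn0.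
by move=> ->; rewrite subsimplex_id.
Qed.

Fact cupr1 : right_id cone cup.
Proof.
move=> f; apply: cochainP => n s; rewrite /cup big_ord_recr /=.
rewrite big1 ?add0r => [|i _]; last first.
  by rewrite -(subnSK (ltn_ord i)) /= mulr0.
by rewrite subnn /= mulr1 subsimplex_id.
Qed.

Fact cupDl : left_distributive cup +%R.
Proof.
move=> f g h; apply: cochainP => n s; rewrite caddE /cup -big_split.
by apply: eq_bigr => i _; rewrite /= caddE mulrDl.
Qed.

Fact cupDr : right_distributive cup +%R.
Proof.
move=> f g h; apply: cochainP => n s; rewrite caddE /cup -big_split.
by apply: eq_bigr => i _; rewrite /= caddE mulrDr.
Qed.

HB.instance Definition _ :=
  GRing.Zmodule_isPzRing.Build cochain cupA cup1r cupr1 cupDl cupDr.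

Lemma addFF (x : 'F_2) : x + x = 0.
Proof. by apply: val_inj; case: x => [[|[|]]]. Qed.

Lemma coboundaryB f g : coboundary (f - g) = coboundary f - coboundary g.
Proof.
apply: cochainP => -[|n] s; rewrite caddE coppE /= ?subr0 //.
by rewrite -sumrB.
Qed.

Lemma cup_recl f g n (s : singular X n.+1) :
  cup f g s = f 0 (subsimplex s 0 (addn 0)) * g n.+1 (subsimplex s n.+1 (addn 0)) +
    \sum_(j < n.+1) f j.+1 (subsimplex s j.+1 (addn 0)) *
                    g (n - j)%N (subsimplex s (n - j) (addn j.+1)).
Proof. by rewrite /cup big_ord_recl; congr (_ + _). Qed.

Lemma coboundaryM f g :
  coboundary (f * g) = coboundary f * g + f * coboundary g.
Proof.
apply: cochainP => -[|n] s.
  by rewrite caddE /GRing.mul /= /cup !big_ord1 /= mul0r mulr0 addr0.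
pose A j i := f j (subsimplex (subsimplex s j.+1 (addn 0)) j (bump i)) *
              g (n - j)%N (subsimplex s (n - j) (addn j.+1)).
pose B j k := f j (subsimplex s j (addn 0)) *
  g (n - j)%N (subsimplex (subsimplex s (n - j).+1 (addn j)) (n - j) (bump k.+1)).
transitivity (\sum_(j < n.+1) (\sum_(i < j.+1) A j i + \sum_(k < (n - j).+1) B j k)).
  rewrite /= /GRing.mul /= /cup exchange_big /=; apply: eq_bigr => j _.
  have jn : (j <= n)%N by rewrite -ltnS.
  rewrite -(big_mkord predT (fun i => f j (subsimplex (subsimplex s n (bump i)) j (addn 0)) *
    g (n - j)%N (subsimplex (subsimplex s n (bump i)) (n - j) (addn j)))).
  rewrite (@big_cat_nat _ _ _ j.+1) //=; last by rewrite ltnS (leq_trans jn).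
  rewrite big_mkord; congr (_ + _).
    apply: eq_bigr => i _; have ij : (i <= j)%N by rewrite -ltnS.
    rewrite /A !subsimplex_comp.
    - congr (f _ _ * g _ _); apply: eq_subsimplex => k kj //=.
      by rewrite /bump (leq_trans ij) ?leq_addr // add1n addSn.
    - by move=> k kj; exact: (leq_add (leq_b1 _) kj).
    - by move=> k kj; rewrite -[X in (_ <= X)%N](subnKC jn) leq_add2l.
    - by move=> k kj; rewrite add0n (leq_trans kj).
  rewrite -{1}[j.+1]add0n big_addn subSS subSn // big_mkord.
  apply: eq_bigr => i _; rewrite /B !subsimplex_comp.
  - congr (_ * _).
      congr (f _ _); apply: eq_subsimplex => k kj /=.
      rewrite /bump add0n leqNgt.
      by rewrite (_ : (k < i + j.+1)%N) // addnS ltnS (leq_trans kj) // leq_addl.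
    congr (g _ _); apply: eq_subsimplex => k kj /=.
    by rewrite /bump addnCA addnS -addSn [(i.+1 + j)%N]addnC leq_add2l.
  - move=> k kj; exact: (leq_add (leq_b1 _) kj).
  - by move=> k kj; rewrite -[X in (_ <= X)%N](subnKC jn) leq_add2l.
  - by move=> k kj; rewrite add0n (leq_trans kj).
rewrite caddE /GRing.mul /= cup_recl /= mul0r add0r /cup.
rewrite [X in _ = _ + X]big_ord_recr /= subnn /= mulr0 addr0 -big_split.
apply: eq_bigr => j _ /=; have jn : (j <= n)%N by rewrite -ltnS.
rewrite subSn //= mulr_suml mulr_sumr.
rewrite [X in _ = X + _]big_ord_recr [X in _ = _ + X]big_ord_recl /=.
have e1 : subsimplex (subsimplex s j.+1 (addn 0)) j (bump j.+1) = subsimplex s j (addn 0).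
  rewrite subsimplex_comp => [|k kj]; last by rewrite /bump ltnNge kj /= add0n leqW.
  by apply: eq_subsimplex => k kj /=; rewrite /bump ltnNge kj.
have e2 : subsimplex (subsimplex s (n - j).+1 (addn j)) (n - j) (bump 0) =
          subsimplex s (n - j) (addn j.+1).
  rewrite subsimplex_comp => [|k kj]; last by rewrite /bump add1n ltnS.
  by apply: eq_subsimplex => k kj /=; rewrite /bump add1n addnS.
by rewrite e1 e2 -[in RHS]addrA [X in _ = _ + X]addrA addFF add0r.
Qed.

End SingularSimplices.

Section Cohomology.
Variables (R : realType) (X : topologicalType).
Local Notation C := (cochain R X).
Implicit Types f g : C.

Definition finite_degree f := exists N, forall n (s : singular R X n), (N <= n)%N -> f n s = 0.

Lemma finite_degreeB f g : finite_degree f -> finite_degree g -> finite_degree (f - g).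
Proof.
move=> [M fM] [N gN]; exists (maxn M N) => n s; rewrite geq_max => /andP[Mn Nn].
by rewrite caddE coppE fM // gN // subr0.
Qed.

Lemma finite_degreeM f g : finite_degree f -> finite_degree g -> finite_degree (f * g).
Proof.
move=> [M fM] [N gN]; exists (M + N)%N => n s MNn.
rewrite /GRing.mul /= /cup big1 // => i _.
have [Mi|iM] := leqP M i; first by rewrite fM // mul0r.
rewrite gN ?mulr0 // leq_subRL; last by rewrite -ltnS.
by rewrite (leq_trans _ MNn) // leq_add2r ltnW.
Qed.

(* Together with finite_degree, the cocycles and coboundaries below are those of
   the direct sum of the C^n(X; Z/2), not of their product. *)
Definition is_cocycle : {pred C} :=
  fun f => `[< coboundary f = 0 /\ finite_degree f >].

Fact cocycle_subring_closed : subring_closed is_cocycle.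
Proof.
split.
- apply/asboolP; split; last by exists 1%N => -[].
  apply: cochainP => -[|[|n]] s //=; last by rewrite big1.
  by rewrite !big_ord_recl big_ord0 addr0 addFF.
- move=> f g /asboolP[df nf] /asboolP[dg ng]; apply/asboolP; split.
    by rewrite coboundaryB df dg subr0.
  exact: finite_degreeB.
- move=> f g /asboolP[df nf] /asboolP[dg ng]; apply/asboolP; split.
    by rewrite coboundaryM df dg mul0r mulr0 addr0.
  exact: finite_degreeM.
Qed.

Record cocycle := Cocycle { cocycle_val :> C; cocycleP : cocycle_val \in is_cocycle }.
HB.instance Definition _ := [isSub of cocycle for cocycle_val].
HB.instance Definition _ := [Choice of cocycle by <:].
HB.instance Definition _ :=
  GRing.SubChoice_isSubPzRing.Build _ _ cocycle cocycle_subring_closed.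

Definition is_coboundary : {pred cocycle} :=
  fun z => `[< exists2 f, finite_degree f & z = coboundary f :> C >].

Fact coboundary_zmod_closed : zmod_closed is_coboundary.
Proof.
split.
  apply/asboolP; exists 0; first by exists 0%N.
  by apply: cochainP => -[|n] s //=; rewrite big1.
move=> y z /asboolP[f nf yf] /asboolP[g ng zg]; apply/asboolP.
exists (f - g); first exact: finite_degreeB.
by rewrite coboundaryB -yf -zg.
Qed.
HB.instance Definition _ := GRing.isZmodClosed.Build _ is_coboundary coboundary_zmod_closed.

Lemma is_coboundaryMl y z : z \in is_coboundary -> y * z \in is_coboundary.
Proof.
case: y => y yZ /asboolP[f nf zf]; have /asboolP[dy ny] := yZ.
apply/asboolP; exists (y * f); first exact: finite_degreeM.
by rewrite coboundaryM dy mul0r add0r -zf.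
Qed.

Lemma is_coboundaryMr y z : z \in is_coboundary -> z * y \in is_coboundary.
Proof.
case: y => y yZ /asboolP[f nf zf]; have /asboolP[dy ny] := yZ.
apply/asboolP; exists (f * y); first exact: finite_degreeM.
by rewrite coboundaryM dy mulr0 addr0 -zf.
Qed.

Local Open Scope quotient_scope.

Definition cohomology : Type := Quotient.quot is_coboundary.
HB.instance Definition _ := GRing.Zmodule.on cohomology.

Definition coclass (z : cocycle) : cohomology := \pi_(Quotient.quot is_coboundary) z.

Lemma coclassP (y z : cocycle) : coclass y = coclass z <-> y - z \in is_coboundary.
Proof. by rewrite Quotient.idealrBE; split=> /eqP. Qed.

Lemma coclass_repr (x : cohomology) : coclass (repr x) = x.
Proof. exact: reprK. Qed.

Lemma coclassD y z : coclass (y + z) = coclass y + coclass z.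
Proof. by rewrite /coclass piE. Qed.

Definition hone : cohomology := coclass 1.
Definition hmul (x y : cohomology) : cohomology := coclass (repr x * repr y).

Lemma hmulE y z : hmul (coclass y) (coclass z) = coclass (y * z).
Proof.
have dy : repr (coclass y) - y \in is_coboundary by apply/coclassP/coclass_repr.
have dz : repr (coclass z) - z \in is_coboundary by apply/coclassP/coclass_repr.
apply/coclassP; set y' := repr _; set z' := repr _.
rewrite (_ : _ - _ = (y' - y) * z' + y * (z' - z)).
  by apply: rpredD; [exact: is_coboundaryMr|exact: is_coboundaryMl].
by rewrite mulrBl mulrBr addrA subrK.
Qed.

Fact hmulA : associative hmul.
Proof.
by move=> x y z; rewrite -[x]coclass_repr -[y]coclass_repr -[z]coclass_repr !hmulE mulrA.
Qed.
Fact hmul1r : left_id hone hmul.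
Proof. by move=> x; rewrite -[x]coclass_repr !hmulE mul1r. Qed.
Fact hmulr1 : right_id hone hmul.
Proof. by move=> x; rewrite -[x]coclass_repr !hmulE mulr1. Qed.
Fact hmulDl : left_distributive hmul +%R.
Proof.
move=> x y z; rewrite -[x]coclass_repr -[y]coclass_repr -[z]coclass_repr.
by rewrite -coclassD !hmulE mulrDl coclassD.
Qed.
Fact hmulDr : right_distributive hmul +%R.
Proof.
move=> x y z; rewrite -[x]coclass_repr -[y]coclass_repr -[z]coclass_repr.
by rewrite -coclassD !hmulE mulrDr coclassD.
Qed.
HB.instance Definition _ :=
  GRing.Zmodule_isPzRing.Build cohomology hmulA hmul1r hmulr1 hmulDl hmulDr.

Definition in_degree (n : nat) : set cohomology :=
  [set coclass z | z in [set z : cocycle |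
     forall m (s : singular R X m), m != n -> cocycle_val z s = 0]].

(* x generates H^n, which is then cyclic of order 2. *)
Definition is_generator (n : nat) (x : cohomology) : Prop :=
  [/\ in_degree n x, x <> 0 & forall y, in_degree n y -> y = 0 \/ y = x].

End Cohomology.

Section Pullback.
Variables (R : realType) (X Y : topologicalType) (f : continuousType X Y).

Definition cochain_pull (c : cochain R Y) : cochain R X := fun n s => c n (f \o s).

Lemma coboundary_pull c : coboundary (cochain_pull c) = cochain_pull (coboundary c).
Proof.
by apply: cochainP => -[|n] s //=; apply: eq_bigr => i _; congr (c _ _); apply/continuousEP.
Qed.

Lemma finite_degree_pull c : finite_degree c -> finite_degree (cochain_pull c).
Proof. by move=> [N cN]; exists N => n s Nn; exact: cN. Qed.

Lemma is_cocycle_pull c : c \in @is_cocycle R Y -> cochain_pull c \in @is_cocycle R X.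
Proof.
move=> /asboolP[dc nc]; apply/asboolP; split; last exact: finite_degree_pull.
by rewrite coboundary_pull dc.
Qed.

Definition cocycle_pull (z : cocycle R Y) : cocycle R X :=
  Cocycle (is_cocycle_pull (cocycleP z)).

Definition pullback (x : cohomology R Y) : cohomology R X :=
  coclass (cocycle_pull (repr x)).

Lemma pullbackE z : pullback (coclass z) = coclass (cocycle_pull z).
Proof.
apply/coclassP; have : repr (coclass z) - z \in @is_coboundary R Y.
  exact/coclassP/coclass_repr.
move=> /asboolP[c nc zc]; apply/asboolP; exists (cochain_pull c).
  exact: finite_degree_pull.
by rewrite coboundary_pull -zc.
Qed.

End Pullback.

Definition set_elt (T : Type) (A : set T) (x : T) (Ax : A x) : A := SigSub (mem_set Ax).
Section Grassmannians.
Variable R : realType.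

(* The (noncompact) Stiefel manifold of k-frames in R^n: a frame is the k x n
   matrix of its rows. *)
Definition frames n k : set 'M[R]_(k, n) := [set A | row_free A].
Arguments frames : clear implicits.

Section OneGrassmannian.
Variables n k : nat.
Local Notation F := (frames n k).
Implicit Types A B : F.

Definition same_span : rel F := fun A B =>
  `[< exists2 P : 'M[R]_k, P \in unitmx & set_val B = P *m set_val A >].

Definition same_orientation : rel F := fun A B =>
  `[< exists2 P : 'M[R]_k, 0 < \det P & set_val B = P *m set_val A >].

Lemma det_gt0_unitmx (P : 'M[R]_k) : 0 < \det P -> P \in unitmx.
Proof. by rewrite unitmxE unitfE => /gt_eqF ->. Qed.

Fact same_span_equiv : equiv_class_of same_span.
Proof.
have sym A B : same_span A B -> same_span B A.
  move=> /asboolP[P Pu BA]; apply/asboolP; exists (invmx P); rewrite ?unitmx_inv //.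
  by rewrite BA mulKmx.
split=> [A|A B|B A D].
- by apply/asboolP; exists 1%:M; rewrite ?unitmx1 // mul1mx.
- by apply/idP/idP; exact: sym.
- move=> /asboolP[P Pu BA] /asboolP[Q Qu DB]; apply/asboolP; exists (Q *m P).
    by rewrite unitmx_mul Qu.
  by rewrite DB BA mulmxA.
Qed.

Fact same_orientation_equiv : equiv_class_of same_orientation.
Proof.
have sym A B : same_orientation A B -> same_orientation B A.
  move=> /asboolP[P Pp BA]; apply/asboolP; exists (invmx P).
    by rewrite det_inv invr_gt0.
  by rewrite BA mulKmx // det_gt0_unitmx.
split=> [A|A B|B A D].
- by apply/asboolP; exists 1%:M; rewrite ?det1 ?ltr01 // mul1mx.
- by apply/idP/idP; exact: sym.
- move=> /asboolP[P Pp BA] /asboolP[Q Qp DB]; apply/asboolP; exists (Q *m P).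
    by rewrite det_mulmx mulr_gt0.
  by rewrite DB BA mulmxA.
Qed.

Canonical same_span_rel := EquivRelPack same_span_equiv.
Canonical same_orientation_rel := EquivRelPack same_orientation_equiv.

Local Open Scope quotient_scope.
(* A k-dimensional subspace is a class of its bases, and an oriented one a class
   of its bases up to a change of basis of positive determinant. *)
Definition Gr : Type := quotient_topology {eq_quot same_span}.
Definition OGr : Type := quotient_topology {eq_quot same_orientation}.
HB.instance Definition _ := Topological.on Gr.
HB.instance Definition _ := Quotient.on Gr.
HB.instance Definition _ := Topological.on OGr.
HB.instance Definition _ := Quotient.on OGr.

Definition forget_orientation (U : OGr) : Gr := \pi_Gr (repr U).

Lemma forget_orientation_continuous : continuous forget_orientation.
Proof.
apply: (@repr_comp_continuous _ _ _ (\pi_Gr : F -> Gr)).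
  exact: pi_continuous.
move=> A B AB; apply/eqP/eqmodP => /=.
have /eqmodP/asboolP[P Pp BA] := eqP AB.
by apply/asboolP; exists P => //; exact: det_gt0_unitmx.
Qed.

Definition obasis (U : OGr) : 'M[R]_(k, n) := set_val (repr U).
Definition basis (U : Gr) : 'M[R]_(k, n) := set_val (repr U).

End OneGrassmannian.


Arguments frames : clear implicits.
Arguments Gr : clear implicits.
Arguments OGr : clear implicits.

Local Open Scope quotient_scope.

Definition usphere n : set 'rV[R]_n := [set v | v *m v^T = 1%:M].
Arguments usphere : clear implicits.

Definition sphere_bundle n k : set (OGr n k * usphere n) :=
  [set x | obasis x.1 *m (set_val x.2)^T = 0].
Arguments sphere_bundle : clear implicits.

Definition sphere_bundle_base n k (x : sphere_bundle n k) : OGr n k := (set_val x).1.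

Lemma add_row_free n k (A : 'M[R]_(k, n)) (v : 'rV[R]_n) :
  row_free A -> v *m v^T = 1%:M -> A *m v^T = 0 -> row_free (col_mx A v).
Proof.
move=> Af v1 Av; rewrite -kermx_eq0; apply/eqP/row_matrixP => i.
set w := row i _; rewrite row0.
have : w *m col_mx A v = 0 by rewrite /w -row_mul mulmx_ker row0.
rewrite -[w]hsubmxK mul_row_col => w0.
have r0 : rsubmx w = 0.
  have := congr1 (mulmx^~ v^T) w0.
  by rewrite mulmxDl -!mulmxA Av v1 mulmx0 add0r mulmx1 mul0mx.
move: w0; rewrite r0 mul0mx addr0 => /eqP.
by rewrite mulmx_free_eq0 // => /eqP ->; rewrite row_mx0.
Qed.

Definition frame_pairs n k : set (frames n k * usphere n) :=
  [set x | set_val x.1 *m (set_val x.2)^T = 0].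
Arguments frame_pairs : clear implicits.

Definition extended_frame n k (x : frame_pairs n k) : frames n (k + 1) :=
  @set_elt _ (frames n (k + 1)) _ (add_row_free (set_valP (set_val x).1)
    (set_valP (set_val x).2) (set_valP x)).

Lemma extended_frame_continuous n k : continuous (@extended_frame n k).
Proof.
apply: (@continuous_comp_initial _ _ _ set_val (@extended_frame n k)).
have c1 : continuous (fun x : frame_pairs n k => set_val (set_val x).1).
  move=> x; apply: (@continuous_comp _ _ _ (fun x : frame_pairs n k => (set_val x).1)).
    apply: (@continuous_comp _ _ _ (set_val : frame_pairs n k -> _) fst).
      exact: initial_continuous.
    exact: cvg_fst.
  exact: initial_continuous.
have c2 : continuous (fun x : frame_pairs n k => set_val (set_val x).2).
  move=> x; apply: (@continuous_comp _ _ _ (fun x : frame_pairs n k => (set_val x).2)).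
    apply: (@continuous_comp _ _ _ (set_val : frame_pairs n k -> _) snd).
      exact: initial_continuous.
    exact: cvg_snd.
  exact: initial_continuous.
apply: mx_continuous => i j; case: (splitP i) => i' ii'.
  have -> : i = lshift 1 i' by exact: val_inj.
  rewrite (_ : (fun x => _) = fun x : frame_pairs n k => set_val (set_val x).1 i' j).
    exact: (entry_continuous c1).
  by apply/funext => x /=; rewrite col_mxEu.
have -> : i = rshift k i' by exact: val_inj.
rewrite (_ : (fun x => _) = fun x : frame_pairs n k => set_val (set_val x).2 i' j).
  exact: (entry_continuous c2).
by apply/funext => x /=; rewrite col_mxEd.
Qed.

Definition bundle_frame_pair n k (x : sphere_bundle n k) : frame_pairs n k :=
  @set_elt _ (frame_pairs n k) (repr (set_val x).1, (set_val x).2) (set_valP x).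

(* span(U, v), oriented by the bases (u_1, ..., u_k, v) with (u_1, ..., u_k) a
   positive basis of U. *)
Definition oriented_span n k (x : sphere_bundle n k) : OGr n (k + 1) :=
  \pi_(OGr n (k + 1)) (extended_frame (bundle_frame_pair x)).

Definition mul_frame n k (P : [set P : 'M[R]_k | 0 < \det P]) (A : frames n k) : frames n k.
Proof.
apply: (@set_elt _ (frames n k) (set_val P *m set_val A)).
rewrite /frames /= -kermx_eq0; apply/eqP/row_matrixP => i; rewrite row0.
have := mulmx_ker (set_val P *m set_val A) => /(congr1 (row i)).
rewrite row0 row_mul mulmxA => /eqP; rewrite mulmx_free_eq0; last exact: set_valP A.
move=> /eqP /(congr1 (mulmx^~ (invmx (set_val P)))).
by rewrite mulmxK ?mul0mx //; exact/det_gt0_unitmx/(set_valP P).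
Defined.

Lemma mul_frame_continuous n k P : continuous (@mul_frame n k P).
Proof.
apply: (@continuous_comp_initial _ _ _ set_val (@mul_frame n k P)).
apply: (@mulmxl_continuous R _ _ _ _ (fun A : frames n k => set_val A)).
exact: initial_continuous.
Qed.

Lemma open_pi n k (O : set (frames n k)) :
  open O -> open ((\pi : frames n k -> OGr n k) @` O).
Proof.
move=> oO; rewrite /open /= /quotient_open.
rewrite (_ : _ @^-1` _ = \bigcup_P (@mul_frame n k P @^-1` O)).
  apply: bigcup_open => P _; apply: open_comp => // A _.
  exact: (@mul_frame_continuous n k P A).
apply/seteqP; split => B /=.
  move=> [A OA /esym/eqmodP/asboolP[P Pp AB]].
  exists (@set_elt _ [set P : 'M[R]_k | 0 < \det P] P Pp) => //=.
  rewrite (_ : mul_frame _ _ = A) //; exact: val_inj.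
move=> [P _ OPB]; exists (mul_frame P B) => //.
apply/esym/eqmodP/asboolP; exists (set_val P) => //; exact: (set_valP P).
Qed.

Lemma oriented_span_continuous n k : continuous (@oriented_span n k).
Proof.
move=> x0 N; rewrite nbhsE => -[O [oO Ox0] ON].
have ch : continuous ((\pi : frames n (k + 1) -> OGr n (k + 1)) \o @extended_frame n k).
  move=> y; apply: continuous_comp; first exact: extended_frame_continuous.
  exact: pi_continuous.
have := open_comp (fun y _ => ch y) oO; move=> [W oW WE].
have Wx0 : W (repr (set_val x0).1, (set_val x0).2).
  have : (set_val @^-1` W) (bundle_frame_pair x0) by rewrite WE.
  by [].
have [[A B] /= [nA nB] ABW] := (open_nbhs_nbhs (conj oW Wx0) : nbhs _ _).
move: nA; rewrite nbhsE => -[A' [oA' A'x0] A'A].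
have nU : nbhs (set_val x0).1 ((\pi : frames n k -> OGr n k) @` A').
  apply: open_nbhs_nbhs; split; first exact: open_pi.
  by exists (repr (set_val x0).1) => //; exact: reprK.
have : nbhs (set_val x0) (((\pi : frames n k -> OGr n k) @` A') `*` B).
  by exists ((\pi : frames n k -> OGr n k) @` A', B).
move=> H; have : nbhs x0 (set_val @^-1` (((\pi : frames n k -> OGr n k) @` A') `*` B)).
  exact: (@initial_continuous _ _ set_val x0 _ H).
apply: (@filterS _ (nbhs x0)) => -[[U v] Uv] /= [[A1 A'A1 AU] Bv].
apply: ON.
have /eqmodP/asboolP[P Pp A1U] : repr U = A1 %[mod OGr n k] by rewrite reprK.
have A1v : frame_pairs n k (A1, v).
  by rewrite /frame_pairs /= A1U -mulmxA (set_mem Uv : obasis U *m _ = 0) mulmx0.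
pose y : frame_pairs n k := set_elt A1v.
have : (set_val @^-1` W) y by apply: ABW; split => //; exact: A'A.
rewrite WE /=; congr (O _).
apply/esym/eqmodP/asboolP; exists (block_mx P 0 0 1%:M).
  by rewrite det_ublock det1 mulr1.
rewrite /= mul_block_col !mul0mx addr0 add0r mul1mx.
by rewrite -A1U.
Qed.

(* f : X -> G_{n,k} is regarded as the rank k subbundle {(x, v) | v in f x} of
   the trivial bundle X x R^n; its projectivization consists of the pairs (x, L)
   with L a line in f x. *)
Section ProjectivizationOfSubbundle.
Variables (X : topologicalType) (n k : nat) (f : continuousType X (Gr n k)).

Definition projectivization : set (X * Gr n 1) :=
  [set x | (basis x.2 <= basis (f x.1))%MS].

Definition proj_base (x : projectivization) : X := (set_val x).1.
Definition proj_line (x : projectivization) : Gr n 1 := (set_val x).2.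

Lemma proj_base_continuous : continuous proj_base.
Proof.
move=> x; apply: (@continuous_comp _ _ _ (set_val : projectivization -> _) fst).
  exact: initial_continuous.
exact: cvg_fst.
Qed.

Lemma proj_line_continuous : continuous proj_line.
Proof.
move=> x; apply: (@continuous_comp _ _ _ (set_val : projectivization -> _) snd).
  exact: initial_continuous.
exact: cvg_snd.
Qed.

(* w is the sequence of Stiefel-Whitney classes of that subbundle, by the
   projective bundle formula: w_0 = 1 and \sum_i w_i x^(k-i) = 0 in the
   cohomology of the projectivization, where x is the pullback of the generator
   of H^1(RP^(n-1)) along (x, L) |-> L. *)
Definition stiefel_whitney (w : nat -> cohomology R X) : Prop :=
  [/\ forall i, in_degree i (w i), w 0 = 1, forall i, (k < i)%N -> w i = 0
    & exists2 x : cohomology R (Gr n 1), is_generator 1 x &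
      \sum_(i < k.+1) pullback (mkcts proj_base_continuous) (w i) *
        pullback (mkcts proj_line_continuous) x ^+ (k - i) = 0].
End ProjectivizationOfSubbundle.

End Grassmannians.

Arguments std_simplex : clear implicits.
Arguments frames : clear implicits.
Arguments Gr : clear implicits.
Arguments OGr : clear implicits.
Arguments usphere : clear implicits.
Arguments sphere_bundle : clear implicits.
Arguments cohomology : clear implicits.

Section SphereBundleMaps.
Variable R : realType.

Definition covering n k : continuousType (OGr R n k) (Gr R n k) :=
  mkcts (@forget_orientation_continuous R n k).

Definition sp n k : continuousType (sphere_bundle R n k) (OGr R n (k + 1)) :=
  mkcts (@oriented_span_continuous R n k).

Definition fiber_inclusion n k d (U : OGr R n k)
    (i : continuousType (usphere R d) (sphere_bundle R n k)) : Prop :=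
  injective i /\ range i = [set x | sphere_bundle_base x = U].

End SphereBundleMaps.
Arguments covering : clear implicits.
Arguments sp : clear implicits.

(* Value of p at v. The cohomology ring is graded-commutative, but this is not
   part of its structure here, so the factors of each monomial are taken in the
   order of the variables. *)
Definition peval (S : pzRingType) n (v : 'I_n -> S) (p : {mpoly 'F_2[n]}) : S :=
  \sum_(m <- msupp p) (p@_m : nat)%:R * \prod_(i < n) v i ^+ m i.

Section Groebner.
Variables (F : fieldType) (n : nat).
Local Notation P := {mpoly F[n]}.
Implicit Types (p q f : P) (G : seq P) (I : set P) (m l : 'X_{1..n}).

Definition ideal_gen G : set P :=
  [set p | exists c : nat -> P, p = \sum_(i < size G) c i * G`_i].

(* Lexicographic ordering of monomials; the variables are listed from the largest
   to the smallest. *)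
Definition lex_le (vars : seq 'I_n) : rel 'X_{1..n} := fun m l =>
  (([seq m i | i <- vars] : seqlexi nat) <= [seq l i | i <- vars])%O.

Variable le : rel 'X_{1..n}.

Definition leading_monomial f l : bool :=
  (l \in msupp f) && all (le^~ l) (msupp f).

Definition standard_monomial G m : Prop :=
  forall f l, f \in G -> leading_monomial f l -> ~~ (l <= m)%MM.

(* The last two clauses say that the cosets modulo I of the standard monomials
   span the quotient and are linearly independent. *)
Definition groebner_basis I G : Prop :=
  [/\ forall f, f \in G -> f != 0,
      forall f, f \in G -> I f,
      forall p, exists2 q,
        (forall m, m \in msupp q -> standard_monomial G m) & I (p - q)
    & forall q, (forall m, m \in msupp q -> standard_monomial G m) ->
        I q -> q = 0].

End Groebner.

Definition w2 : {mpoly 'F_2[3]} := 'X_(@Ordinal 3 0 isT).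
Definition w3 : {mpoly 'F_2[3]} := 'X_(@Ordinal 3 1 isT).
Definition w4 : {mpoly 'F_2[3]} := 'X_(@Ordinal 3 2 isT).

(* gpoly_shift r is g_(r-3). *)
Fixpoint gpoly_shift (r : nat) : {mpoly 'F_2[3]} :=
  match r with
  | 0 | 1 | 2 => 0
  | 3 => 1
  | ((r0.+1 as r1).+1 as r2).+2 =>
      w2 * gpoly_shift r2 + w3 * gpoly_shift r1 + w4 * gpoly_shift r0
  end.

Definition gpoly (r : nat) : {mpoly 'F_2[3]} := gpoly_shift (r + 3).

(* In four variables, w_2, w_3, w_4 are the images under mwiden of the variables
   above, i.e. the variables of index 0, 1, 2, and a is the last one. *)
Definition avar : {mpoly 'F_2[4]} := 'X_ord_max.

Definition arel (P Q : {mpoly 'F_2[3]}) : {mpoly 'F_2[4]} :=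
  avar ^+ 2 + mwiden P * avar + mwiden Q.

(* w_3 < w_2 < w_4 < a *)
Definition lex_w3_w2_w4_a : rel 'X_{1..4} :=
  lex_le [:: ord_max; @Ordinal 4 2 isT; @Ordinal 4 0 isT; @Ordinal 4 1 isT].

(* Main.v *)
Require Import Defs.
From mathcomp Require Import all_boot all_order all_algebra.
From mathcomp Require Import all_classical reals topology.
From mathcomp Require Import mpoly.
From mathcomp Require Import ring zify.
Import numFieldTopology.Exports.

Set Implicit Arguments.
Unset Strict Implicit.
Unset Printing Implicit Defensive.
Import Order.TTheory GRing.Theory.
Local Open Scope classical_set_scope.
Local Open Scope ring_scope.

(** The ordering puts [a] first and [w_4] second, so the leading monomial of
[a^2 + P a + Q] is [a^2] for all [P] and [Q] in the other variables, and what is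
to be proved is a fact about the polynomials [g_r].

Write [h_m = g_(m-3)]. In characteristic 2 the linear recurrence of the [g_r]
can be squared, which gives, for every power [q] of 2 ([gshift_frobenius]),
[h_(m+4q) = w_2^q h_(m+2q) + w_3^q h_(m+q) + w_4^q h_m]. Everything follows from
this identity. It gives [h_(2^t) = 0]; hence [f_i = h_(2^t+2^i)], which is
[g_(2^t-3+2^i)], involves only [w_2] and [w_3], with leading monomial
[w_2^(2^(t-1)-2^i) w_3^(2^i-1)] ([leading_staircase]), while
[h_(2^t+3) = g_(2^t)] is monic in [w_4] of degree [2^(t-2)] ([leading_w4]). It
gives also the relations [w_3^(2^i) f_i = w_2^(2^i) f_(i+1) + f_(i+2)], with
[f_t = 0] ([staircase_syzygy]), between consecutive steps of the staircase
formed by the leading monomials of the [f_i].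

The Groebner property comes from an argument on unique representations
([cones_groebner]). Each generator [f] gets a set of multipliers: all monomials
for [a^2 + P a + Q]; those not divisible by [a^2] for [g_(2^t)]; those divisible
neither by [a^2] nor by [w_4^(2^(t-2))], and with exponent of [w_3] less than
[2^i], for [f_i] with [i < t-1]; the last condition is dropped for [f_(t-1)].
A product of a generator by a monomial that is not one of its multipliers can be
rewritten, by a division or by a relation above, with later generators or
smaller monomials ([basis_rewrites]); hence every element of the ideal is a
combination of products by multipliers. The sets of leading monomials of these
products are pairwise disjoint for distinct generators; for the [f_i] this is
seen on the exponents of [w_3], which are at least [2^i - 1] and, for [i < t-1],
at most [2^(i+1) - 2] ([basis_disjoint]). So no leading terms cancel, and the
leading monomial of a nonzero element of the ideal is divisible by that of a
generator. *)

(** * Lexicographic orderings *)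

Section Lex.
Variables (n : nat) (vars : seq 'I_n).
Implicit Types m l k : 'X_{1..n}.

Definition lex_lt m l : bool :=
  (([seq m i | i <- vars] : seqlexi nat) < [seq l i | i <- vars])%O.

Lemma lex_leNgt m l : lex_le vars m l = ~~ lex_lt l m.
Proof. exact: leNgt. Qed.

Lemma lex_lexx m : lex_le vars m m.
Proof. exact: lexx. Qed.

Lemma lex_ltW m l : lex_lt m l -> lex_le vars m l.
Proof. exact: ltW. Qed.

Lemma lex_lt_trans m l k : lex_lt m l -> lex_lt l k -> lex_lt m k.
Proof. exact: lt_trans. Qed.

Lemma lex_le_trans m l k : lex_le vars m l -> lex_le vars l k -> lex_le vars m k.
Proof. exact: le_trans. Qed.

Lemma lex_total m l : lex_le vars m l || lex_le vars l m.
Proof. exact: le_total. Qed.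

Hypothesis all_vars : forall i, i \in vars.

Lemma lex_lt_neqle m l : lex_lt m l = (m != l) && lex_le vars m l.
Proof.
rewrite /lex_lt lt_neqAle; congr (~~ _ && _).
apply/eqP/eqP => [/eq_in_map eq_ml|-> //].
by apply/mnmP => i; exact: eq_ml.
Qed.
End Lex.

Lemma lex_lt_add n vars (m l k : 'X_{1..n}) :
  lex_lt vars (m + k)%MM (l + k)%MM = lex_lt vars m l.
Proof.
elim: vars => //= i vars IH; move: IH; rewrite /lex_lt /= !ltxi_cons => ->.
by rewrite !mnmDE !leEnat !leq_add2r.
Qed.

Lemma lex_lt_add2 n vars (m m' l l' : 'X_{1..n}) :
  lex_lt vars m m' -> lex_le vars l l' -> lex_lt vars (m + l)%MM (m' + l')%MM.
Proof.
move=> mm' ll'; apply: (lt_le_trans (y := [seq (m' + l)%MM i | i <- vars] : seqlexi nat)).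
  by move: mm'; rewrite -(lex_lt_add vars m m' l).
suff : lex_le vars (m' + l)%MM (m' + l')%MM by [].
by rewrite ![(m' + _)%MM]addmC lex_leNgt lex_lt_add -lex_leNgt.
Qed.

(** A lexicographic ordering of finitely many exponents is well-founded, by
induction on the list of variables and then on the first exponent. *)
Lemma lex_lt_ind n vars (S : 'X_{1..n} -> Prop) :
  (forall m, (forall l, lex_lt vars l m -> S l) -> S m) -> forall m, S m.
Proof.
elim: vars S => [|i vars IH] S HS m; first by apply: HS => l.
have [k] := ubnP (m i); elim: k m => // k IHk m mk.
apply: (IH (fun m => m i <= k -> S m)%N) mk => {}m {}IH mk; apply: HS => l.
rewrite /lex_lt /= ltxi_cons leEnat => /andP[]; rewrite leq_eqVlt.
case/orP=> [/eqP lm /implyP lt_lm|lm _]; last by apply: IHk; rewrite (leq_trans lm).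
by apply: IH; rewrite ?lm //; apply: lt_lm; rewrite lm.
Qed.

(** * Finitely generated ideals *)

Section Ideal.
Variables (F : fieldType) (n : nat).
Local Notation P := {mpoly F[n]}.
Implicit Types (p q : P) (G : seq P).

Lemma ideal_gen_nth G j : (j < size G)%N -> ideal_gen G G`_j.
Proof.
move=> jG; exists (fun k => (k == j)%:R).
rewrite (bigD1 (Ordinal jG)) //= eqxx mul1r big1 ?addr0 // => k kj.
by rewrite (_ : (k == j :> nat) = false) ?mul0r //; apply/negbTE.
Qed.

Lemma ideal_gen_in G f : f \in G -> ideal_gen G f.
Proof. by case/(nthP 0) => j jG <-; exact: ideal_gen_nth. Qed.

Lemma ideal_gen0 G : ideal_gen G 0.
Proof. by exists (fun=> 0); rewrite big1 // => k _; rewrite mul0r. Qed.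

Lemma ideal_genD G p q : ideal_gen G p -> ideal_gen G q -> ideal_gen G (p + q).
Proof.
move=> [c ->] [d ->]; exists (fun k => c k + d k).
by rewrite -big_split; apply: eq_bigr => k _; rewrite mulrDl.
Qed.

Lemma ideal_genM G p q : ideal_gen G q -> ideal_gen G (p * q).
Proof.
move=> [c ->]; exists (fun k => p * c k).
by rewrite mulr_sumr; apply: eq_bigr => k _; rewrite mulrA.
Qed.

Lemma ideal_gen_sum G (I : Type) (r : seq I) (A : I -> P) :
  (forall i, ideal_gen G (A i)) -> ideal_gen G (\sum_(i <- r) A i).
Proof. by move=> GA; apply: big_ind => //; [exact: ideal_gen0|exact: ideal_genD]. Qed.

Lemma ideal_gen_sub G G' : (forall f, f \in G' -> ideal_gen G f) ->
  ideal_gen G' `<=` ideal_gen G.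
Proof.
move=> sG p [c ->]; apply: ideal_gen_sum => k.
by apply/ideal_genM/sG/mem_nth.
Qed.
End Ideal.

(** * Leading monomials *)

Section Leading.
Variables (F : fieldType) (n : nat) (vars : seq 'I_n).
Hypothesis all_vars : forall i, i \in vars.
Local Notation P := {mpoly F[n]}.
Local Notation leading := (leading_monomial (lex_le vars)).
Local Notation "m <l l" := (lex_lt vars m l) (at level 70).
Implicit Types (p q f : P) (m l : 'X_{1..n}).

Definition below m p := forall l, l \in msupp p -> l <l m.

Lemma below0 m : below m 0.
Proof. by move=> l; rewrite msupp0. Qed.

Lemma belowD m p q : below m p -> below m q -> below m (p + q).
Proof. by move=> bp bq l /msuppD_le; rewrite mem_cat => /orP[/bp|/bq]. Qed.

Lemma belowN m p : below m p -> below m (- p).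
Proof. by move=> bp l; rewrite (perm_mem (msuppN p)) => /bp. Qed.

Lemma leading_below p m l : leading p m -> m <l l -> below l p.
Proof. by move=> /andP[_ /allP pm] ml k /pm km; exact: le_lt_trans ml. Qed.

Lemma leading_exists p : p != 0 -> exists m, leading p m.
Proof.
rewrite -msupp_eq0 /leading_monomial; elim: (msupp p) => //= m [_ _|l s /(_ isT) [k]].
  by exists m; rewrite mem_head lex_lexx.
case/andP=> ks /allP ak _; case/orP: (lex_total vars m k) => mk.
  by exists k; rewrite in_cons ks orbT mk; apply/allP.
exists m; rewrite mem_head lex_lexx; apply/allP => j /ak jk.
exact: lex_le_trans mk.
Qed.

Lemma leading_nz p m : leading p m -> p != 0.
Proof. by case/andP => + _; apply: contraTneq => ->; rewrite msupp0. Qed.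

Lemma leading_coef p m : leading p m -> p@_m != 0.
Proof. by case/andP => + _; rewrite mcoeff_msupp. Qed.

Lemma leading_tail p m : leading p m -> below m (p - p@_m *: 'X_[m]).
Proof.
case/andP=> mp /allP pm l; rewrite mcoeff_msupp mcoeffB mcoeffZ mcoeffX.
rewrite lex_lt_neqle // [l == m]eq_sym.
have [->|ml] := eqVneq m l; first by rewrite mulr1 subrr eqxx.
by rewrite mulr0 subr0 -mcoeff_msupp => /pm.
Qed.

Lemma below_coef m p : below m p -> p@_m = 0.
Proof.
move=> bp; apply/eqP; rewrite mcoeff_eq0; apply/negP => /bp.
by rewrite lex_lt_neqle // eqxx.
Qed.

Lemma leading_add p q m : leading p m -> below m q -> leading (p + q) m.
Proof.
move=> lp bq; apply/andP; split.
  by rewrite mcoeff_msupp mcoeffD (below_coef bq) addr0 leading_coef.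
apply/allP => l /msuppD_le; rewrite mem_cat => /orP[|/bq/lex_ltW //].
by case/andP: lp => _ /allP; exact.
Qed.

Lemma leading_X m : leading ('X_[m] : P) m.
Proof. by rewrite /leading_monomial msuppX mem_head /= lex_lexx. Qed.

Lemma leadingZ c p m : c != 0 -> leading p m -> leading (c *: p) m.
Proof.
move=> c0 /andP[mp pm]; rewrite /leading_monomial.
by rewrite (perm_mem (msuppZ _ c0)) mp (perm_all _ (msuppZ _ c0)).
Qed.

Lemma belowM p q m l : below m p -> leading q l -> below (m + l)%MM (p * q).
Proof.
move=> bp /andP[_ /allP ql] k /msuppM_le /allpairsP [[i j] /= [ip jq ->]].
by apply: lex_lt_add2; [exact: bp|exact: ql].
Qed.

Lemma leadingM p q m l : leading p m -> leading q l -> leading (p * q) (m + l)%MM.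
Proof.
move=> lp lq; rewrite -[p](subrK (p@_m *: 'X_[m])) addrC mulrDl.
apply: leading_add; last exact: belowM (leading_tail lp) lq.
rewrite -[q](subrK (q@_l *: 'X_[l])) addrC mulrDr; apply: leading_add.
  rewrite -scalerAl -scalerAr -mpolyXD.
  by do 2!(apply: leadingZ; first exact: leading_coef); exact: leading_X.
rewrite mulrC addmC; apply: belowM (leading_tail lq) _.
by apply: leadingZ (leading_X _); exact: leading_coef.
Qed.

(** One step of the division algorithm on the monomial [m]. *)
Lemma cancel_leading f l m : leading f l -> (l <= m)%MM ->
  below m ('X_[m] - (f@_l)^-1 *: 'X_[m - l] * f).
Proof.
move=> lf lem; have -> : 'X_[m] - (f@_l)^-1 *: 'X_[m - l] * f =
    - ((f - f@_l *: 'X_[l]) * ((f@_l)^-1 *: 'X_[m - l])).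
  rewrite mulrBl opprB -[in RHS]scalerAr -[in RHS]scalerAl scalerA.
  by rewrite mulVf ?leading_coef // scale1r -mpolyXD addmC submK // [f * _]mulrC.
apply: belowN; rewrite -[m in below m](submK lem) addmC.
apply: belowM (leading_tail lf) _; apply: leadingZ (leading_X _).
by rewrite invr_neq0 // leading_coef.
Qed.

(** Zero is included so that the predicate is compatible with sums of
polynomials some of which vanish. *)
Definition leads_in (D : 'X_{1..n} -> Prop) p := p = 0 \/ exists2 m, leading p m & D m.

(** The leading monomials lie in disjoint sets, so they are distinct and the
larger one survives in the sum. *)
Lemma leads_in_add (D1 D2 : 'X_{1..n} -> Prop) p q :
  (forall m, D1 m -> D2 m -> False) -> leads_in D1 p -> leads_in D2 q ->
  leads_in (fun m => D1 m \/ D2 m) (p + q).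
Proof.
move=> D12 [->|[m lp Dm]].
  by rewrite add0r => -[->|[l lq Dl]]; [left|right; exists l; auto].
case=> [->|[l lq Dl]]; first by rewrite addr0; right; exists m; auto.
have ml : m != l by apply/eqP => ml; apply: (D12 m); rewrite // ml.
case/orP: (lex_total vars m l) => lm.
  right; exists l; last by right.
  rewrite addrC; apply: leading_add => //; apply: leading_below lp _.
  by rewrite lex_lt_neqle // ml.
right; exists m; last by left.
apply: leading_add => //; apply: leading_below lq _.
by rewrite lex_lt_neqle // eq_sym ml.
Qed.

Lemma leads_in_sum N (D : nat -> 'X_{1..n} -> Prop) (p : nat -> P) :
  (forall (j k : nat) m, (j < k < N)%N -> D j m -> D k m -> False) ->
  (forall j, (j < N)%N -> leads_in (D j) (p j)) ->
  leads_in (fun m => exists2 j, (j < N)%N & D j m) (\sum_(j < N) p j).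
Proof.
elim: N => [|N IH] Dd Dp; first by left; rewrite big_ord0.
rewrite big_ord_recr /=.
have := leads_in_add _ (IH _ _) (Dp N (ltnSn _)).
case.
- by move=> m [j jN Dj] DN; apply: (Dd j N m); rewrite ?jN /=.
- by move=> j k m /andP[jk kN]; apply: Dd; rewrite jk ltnW.
- by move=> j jN; apply: Dp; exact: ltnW.
- by left.
case=> m lm [[j jN Dj]|DN]; right; exists m => //; first by exists j; rewrite // ltnW.
by exists N.
Qed.

(** * A Groebner criterion by multipliers *)

Section Criterion.
Variables (G : seq P) (lm : nat -> 'X_{1..n}) (mult : nat -> pred 'X_{1..n}).

(** The product of the [j]-th generator by a monomial is expressed by later
generators and by products of the same generator by smaller monomials, so that
iterating such rewritings terminates. *)
Definition rewrites j m := exists c : nat -> P,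
  [/\ 'X_[m] * G`_j = \sum_(k < size G) c k * G`_k,
      forall k : nat, (k < j)%N -> c k = 0 & below m (c j)].

(** Elements that are combinations of products of the generators by their own
multipliers; the leading monomials of the products for one generator form a cone
with apex the leading monomial of that generator. *)
Definition in_cones p := exists2 c : nat -> P,
  (forall j m, m \in msupp (c j) -> mult j m) & p = \sum_(j < size G) c j * G`_j.

Lemma in_cones0 : in_cones 0.
Proof.
by exists (fun=> 0) => [j m|]; [rewrite msupp0|rewrite big1 // => j _; rewrite mul0r].
Qed.

Lemma in_conesD p q : in_cones p -> in_cones q -> in_cones (p + q).
Proof.
move=> [c Ec ->] [d Ed ->]; exists (fun j => c j + d j).
  by move=> j m /msuppD_le; rewrite mem_cat => /orP[/Ec|/Ed].
by rewrite -big_split; apply: eq_bigr => k _; rewrite mulrDl.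
Qed.

Lemma in_conesZ a p : in_cones p -> in_cones (a *: p).
Proof.
move=> [c Ec ->]; exists (fun j => a *: c j); first by move=> j m /msuppZ_le /Ec.
by rewrite scaler_sumr; apply: eq_bigr => k _; rewrite scalerAl.
Qed.

Lemma in_cones_mul c j :
  (forall m, m \in msupp c -> in_cones ('X_[m] * G`_j)) -> in_cones (c * G`_j).
Proof.
move=> Hc; rewrite [c]mpolyE mulr_suml big_seq; apply: big_ind.
- exact: in_cones0.
- exact: in_conesD.
- by move=> m mc; rewrite -scalerAl; apply/in_conesZ/Hc.
Qed.

(** Induction on the generator, from the last one to the first, and then on the
monomial that multiplies it. *)
Lemma ideal_in_cones :
  (forall j m, (j < size G)%N -> ~~ mult j m -> rewrites j m) ->
  ideal_gen G `<=` in_cones.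
Proof.
move=> rew.
suff H j m : (j < size G)%N -> in_cones ('X_[m] * G`_j).
  move=> p [c ->]; apply: big_ind => [||k _]; [exact: in_cones0|exact: in_conesD|].
  by apply: in_cones_mul => m _; exact: H.
have [d] := ubnP (size G - j); elim: d j m => // d IHd j m jd jG.
elim/(@lex_lt_ind _ vars): m => m IHm.
have [Em|Em] := boolP (mult j m).
  exists (fun k : nat => if k == j then 'X_[m] else 0) => [k l|].
    by case: eqP => [->|_]; rewrite ?msuppX ?msupp0 // inE => /eqP ->.
  rewrite (bigD1 (Ordinal jG)) //= eqxx big1 ?addr0 // => k kj.
  by rewrite (_ : (k == j :> nat) = false) ?mul0r //; apply/negbTE.
have [c [-> c0 cj]] := rew j m jG Em.
apply: big_ind => [||k _]; [exact: in_cones0|exact: in_conesD|].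
apply: in_cones_mul => l; have [kj|jk|kj] := ltngtP k j.
- by rewrite c0 // msupp0.
- by move=> _; apply: IHd => //; rewrite -ltnS (leq_trans _ jd) // ltnS ltn_sub2l.
by rewrite kj => /cj /IHm.
Qed.

Definition delta (j : nat) p : nat -> P := fun k => if k == j then p else 0.

Lemma sum_delta j p : (j < size G)%N -> \sum_(k < size G) delta j p k * G`_k = p * G`_j.
Proof.
move=> jG; rewrite (bigD1 (Ordinal jG)) //= /delta eqxx big1 ?addr0 // => k kj.
by rewrite (_ : (k == j :> nat) = false) ?mul0r //; apply/negbTE.
Qed.

Hypothesis leadG : forall j, (j < size G)%N -> leading G`_j (lm j).

(** When [lm k] divides [m], the product of [G`_j] by the monomial [m] is divided
by [G`_k], as if [G`_j] were a coefficient: the quotient goes to [G`_k], and the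
remainder multiplies [G`_j] by smaller monomials. *)
Lemma rewrites_leading (j k : nat) m :
  (j < k < size G)%N -> (lm k <= m)%MM -> rewrites j m.
Proof.
move=> /andP[jk kG] lem; have := leadG kG; set l := lm k => lf.
pose d := ((G`_k)@_l)^-1 *: 'X_[m - l].
exists (fun i => delta j ('X_[m] - d * G`_k) i + delta k (d * G`_j) i); split.
- under [RHS]eq_bigr do rewrite mulrDl.
  rewrite big_split /= !sum_delta ?(ltn_trans jk) //.
  by rewrite mulrBl [d * G`_j * _]mulrAC subrK.
- by move=> i ij; rewrite /delta !ltn_eqF ?addr0 // (ltn_trans ij).
- by rewrite /delta eqxx (ltn_eqF jk) addr0; exact: cancel_leading.
Qed.

Definition reduces p := exists2 q,
  (forall m, m \in msupp q -> standard_monomial (lex_le vars) G m) & ideal_gen G (p - q).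

Lemma reduces_ideal p : ideal_gen G p -> reduces p.
Proof. by move=> Gp; exists 0; rewrite ?subr0 // => m; rewrite msupp0. Qed.

Lemma reducesD p q : reduces p -> reduces q -> reduces (p + q).
Proof.
move=> [p' sp Ip] [q' sq Iq]; exists (p' + q').
  by move=> m /msuppD_le; rewrite mem_cat => /orP[/sp|/sq].
by rewrite opprD addrACA; exact: ideal_genD.
Qed.

Lemma reducesZ a p : reduces p -> reduces (a *: p).
Proof.
move=> [q sq Iq]; exists (a *: q); first by move=> m /msuppZ_le /sq.
by rewrite -scalerBr -mul_mpolyC; exact: ideal_genM.
Qed.

Lemma reduces_monomials p : (forall m, m \in msupp p -> reduces 'X_[m]) -> reduces p.
Proof.
move=> rX; rewrite [p]mpolyE big_seq; apply: big_ind.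
- exact/reduces_ideal/ideal_gen0.
- exact: reducesD.
- by move=> m mp; exact/reducesZ/rX.
Qed.

(** The division algorithm, which terminates since the ordering is well-founded. *)
Lemma reduces_all p : reduces p.
Proof.
apply: reduces_monomials => m _; elim/(@lex_lt_ind _ vars): m => m IHm.
have [sm|/existsNP[f /existsNP[l /not_implyP[fG /not_implyP[lf /negP]]]]] :=
    pselect (standard_monomial (lex_le vars) G m).
  exists 'X_[m]; first by move=> l; rewrite msuppX inE => /eqP ->.
  by rewrite subrr; exact: ideal_gen0.
rewrite negbK => lem.
rewrite -['X_[m]](subrK ((f@_l)^-1 *: 'X_[m - l] * f)); apply: reducesD.
  by apply: reduces_monomials => k km; exact/IHm/(cancel_leading lf lem).
exact/reduces_ideal/ideal_genM/ideal_gen_in.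
Qed.

(** Disjointness of the cones prevents the leading terms of the summands of an
element of [in_cones] from cancelling, so a nonzero element of the ideal has a
leading monomial which is not standard. *)
Lemma cones_groebner :
  (forall (j k : nat) m l, (j < k < size G)%N -> mult j m -> mult k l ->
     (m + lm j)%MM != (l + lm k)%MM) ->
  (forall j m, (j < size G)%N -> ~~ mult j m -> rewrites j m) ->
  groebner_basis (lex_le vars) (ideal_gen G) G.
Proof.
move=> disj rew; split.
- by move=> f /(nthP 0) [j jG <-]; exact: leading_nz (leadG jG).
- by move=> f; exact: ideal_gen_in.
- exact: reduces_all.
move=> q sq /(ideal_in_cones rew) [c Ec qE].
have [//|[m]] : leads_in (fun m => exists2 j, (j < size G)%N &
    exists2 l, mult j l & m = (l + lm j)%MM) q.
  rewrite qE; apply: (leads_in_sum (p := fun j => c j * G`_j)).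
    move=> j k m jk [l El ->] [l' El' /eqP]; apply/negP; exact: disj.
  move=> j jG; have [->|/leading_exists[l ll]] := eqVneq (c j) 0; first by left; rewrite mul0r.
  right; exists (l + lm j)%MM; first by apply: leadingM => //; exact: leadG.
  by exists l => //; apply: Ec; case/andP: ll.
move=> lq [j jG [l _ mE]]; have /andP[/sq sm _] := lq.
have := sm _ _ (mem_nth 0 jG) (leadG jG); rewrite mE.
by case/negP; apply/mnm_lepP => i; rewrite mnmDE leq_addl.
Qed.
End Criterion.
End Leading.

(** * The recurrence of the polynomials g in characteristic 2 *)

Local Notation R4 := {mpoly 'F_2[4]}.
Local Notation iw2 := (@Ordinal 4 0 isT).
Local Notation iw3 := (@Ordinal 4 1 isT).
Local Notation iw4 := (@Ordinal 4 2 isT).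
Local Notation iva := (@ord_max 3).
Local Notation vars := [:: iva; iw4; iw2; iw3].
Local Notation leading := (leading_monomial (lex_le vars)).

Lemma all_vars4 (i : 'I_4) : i \in vars.
Proof. by case: i => [[|[|[|[|]]]]] lt_i //; rewrite !inE -!val_eqE. Qed.

Lemma lex_lt4E (m l : 'X_{1..4}) : lex_lt vars m l =
  [|| m iva < l iva, (m iva == l iva) && (m iw4 < l iw4),
      [&& m iva == l iva, m iw4 == l iw4 & m iw2 < l iw2] |
      [&& m iva == l iva, m iw4 == l iw4, m iw2 == l iw2 & m iw3 < l iw3]]%N.
Proof.
rewrite /lex_lt /= !ltxi_cons ltxi0s eqxx !leEnat !implybF.
lia.
Qed.

Lemma addpp (p : R4) : p + p = 0.
Proof. by apply/mpolyP => m; rewrite mcoeffD addFF mcoeff0. Qed.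

Fact gshift_key : unit. Proof. exact: tt. Qed.

(** The shift by 3 gives a recurrence valid from index 0 on and puts the zero
[g_(2^t-3)] at index [2^t]. It is locked so that two instances are compared by
their indices, such as [2 ^ t], and not by computing the recurrence. *)
Definition gshift m : R4 := locked_with gshift_key (mwiden (gpoly_shift m)).

Lemma gshiftE m : gshift m = mwiden (gpoly_shift m).
Proof. exact: locked_withE. Qed.

Lemma mwiden_gpoly r m : (r + 3)%N = m -> mwiden (gpoly r) = gshift m.
Proof. by move=> <-; rewrite gshiftE. Qed.

Lemma gshiftS m : gshift (m + 4) =
  'X_iw2 * gshift (m + 2) + 'X_iw3 * gshift (m + 1) + 'X_iw4 * gshift m.
Proof.
have wX j k : widen_ord (leqnSn 3) j = k -> mwiden ('X_j : {mpoly 'F_2[3]}) = 'X_k.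
  by move=> <-; rewrite mwidenX mnmwiden1.
rewrite !addnS addn0 !gshiftE /= !mwidenD !mwidenM.
by congr (_ * _ + _ * _ + _ * _); apply: wX; exact: val_inj.
Qed.

(** If the shift operator [S] satisfies [S^4 = x S^2 + y S + z], squaring this in
characteristic 2 gives [S^8 = x^2 S^4 + y^2 S^2 + z^2]. *)
Lemma recurrence_square (A : comPzRingType) (x y z h0 h1 h2 h3 h4 : A) :
  (forall p : A, p + p = 0) ->
  x * (x * h4 + y * h3 + z * h2) + y * (x * h3 + y * h2 + z * h1)
    + z * (x * h2 + y * h1 + z * h0) = x ^+ 2 * h4 + y ^+ 2 * h2 + z ^+ 2 * h0.
Proof.
move=> char2; apply/eqP; rewrite -subr_eq0; apply/eqP.
rewrite -[RHS](char2 (x * y * h3 + x * z * h2 + y * z * h1)); ring.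
Qed.

(** The characteristic polynomial of the recurrence, raised to the power [2^s]. *)
Lemma gshift_frobenius s m : gshift (m + 4 * 2 ^ s) =
  'X_iw2 ^+ (2 ^ s) * gshift (m + 2 * 2 ^ s) +
  'X_iw3 ^+ (2 ^ s) * gshift (m + 2 ^ s) + 'X_iw4 ^+ (2 ^ s) * gshift m.
Proof.
elim: s m => [|s IH] m; first by rewrite !expr1; exact: gshiftS.
rewrite expnS; move: (2 ^ s)%N IH => q IH.
have -> : (m + 4 * (2 * q) = m + 4 * q + 4 * q)%N by lia.
rewrite IH IH; have -> : (m + 4 * q + 2 * q = m + 2 * q + 4 * q)%N by lia.
have -> : (m + 4 * q + q = m + q + 4 * q)%N by lia.
rewrite !IH; have -> : (m + 2 * q + 2 * q = m + 4 * q)%N by lia.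
have -> : (m + q + 2 * q = m + 2 * q + q)%N by lia.
have -> : (m + q + q = m + 2 * q)%N by lia.
have -> : (m + 2 * (2 * q) = m + 4 * q)%N by lia.
have sq (p : R4) : p ^+ (2 * q) = (p ^+ q) ^+ 2 by rewrite mulnC exprM.
rewrite !sq.
exact/recurrence_square/addpp.
Qed.

Lemma gshift_small m : (m < 3)%N -> gshift m = 0.
Proof. by case: m => [|[|[|]]] // _; rewrite gshiftE mwiden0. Qed.

Lemma gshift3 : gshift 3 = 1.
Proof. by rewrite gshiftE mwiden1. Qed.

Lemma gshift_pow2D t m : gshift (2 ^ t.+2 + m) =
  'X_iw2 ^+ (2 ^ t) * gshift (2 ^ t.+1 + m) +
  'X_iw3 ^+ (2 ^ t) * gshift (2 ^ t + m) + 'X_iw4 ^+ (2 ^ t) * gshift m.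
Proof.
have -> : (2 ^ t.+2 + m = m + 4 * 2 ^ t)%N by rewrite !expnS; lia.
have -> : (2 ^ t.+1 + m = m + 2 * 2 ^ t)%N by rewrite expnS; lia.
by rewrite [(2 ^ t + m)%N]addnC; exact: gshift_frobenius.
Qed.

Lemma gshift_pow2 t : gshift (2 ^ t) = 0.
Proof.
elim/ltn_ind: t => -[_|[_|t IH]]; [exact: gshift_small|exact: gshift_small|].
rewrite -[(2 ^ t.+2)%N]addn0 gshift_pow2D !addn0 !IH ?gshift_small //.
by rewrite !mulr0 !addr0.
Qed.

Lemma gshift_3pow2 i : gshift (3 * 2 ^ i) = 'X_iw3 ^+ (2 ^ i - 1).
Proof.
elim: i => [|i IH]; first by rewrite muln1 subnn expr0 gshift3.
have -> : (3 * 2 ^ i.+1 = 2 ^ i.+2 + 2 ^ i.+1)%N by rewrite !expnS; lia.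
rewrite gshift_pow2D addnn -mul2n -expnS !gshift_pow2 !mulr0 add0r addr0.
have -> : (2 ^ i + 2 ^ i.+1 = 3 * 2 ^ i)%N by rewrite expnS; lia.
rewrite IH -exprD; congr (_ ^+ _).
by have := expn_gt0 2 i; rewrite expnS; lia.
Qed.

(** * Leading monomials of the generators *)

Definition staircase t i : 'X_{1..4} :=
  (U_(iw2) *+ (2 ^ t.-1 - 2 ^ i) + U_(iw3) *+ (2 ^ i - 1))%MM.

Lemma leading_mulXn (i : 'I_4) k (p : R4) m :
  leading p m -> leading ('X_i ^+ k * p) (U_(i) *+ k + m)%MM.
Proof.
move=> lp; apply: (leadingM all_vars4) => //.
by rewrite mpolyXn; exact: leading_X.
Qed.

(** As [gshift (2 ^ i)] vanishes, the term with [w_4] disappears in the recurrence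
for [gshift (2 ^ t + 2 ^ i)]; the term with [w_2] has the larger exponent of
[w_2]. *)
Lemma leading_staircase t i : (i < t)%N -> leading (gshift (2 ^ t + 2 ^ i)) (staircase t i).
Proof.
elim/ltn_ind: t => t IH it; have [->|ti] := eqVneq t i.+1.
  have -> : (2 ^ i.+1 + 2 ^ i = 3 * 2 ^ i)%N by rewrite expnS; lia.
  by rewrite gshift_3pow2 /staircase subnn mulm0n add0m mpolyXn; exact: leading_X.
case: t it ti IH => [|[|t]] //; first by case: i.
move=> it ti IH; have {}it : (i <= t)%N by move: it ti; rewrite ltnS; lia.
rewrite gshift_pow2D gshift_pow2 mulr0 addr0.
have -> : staircase t.+2 i = (U_(iw2) *+ 2 ^ t + staircase t.+1 i)%MM.
  have : (2 ^ i <= 2 ^ t)%N by rewrite leq_exp2l.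
  move=> le_it; apply/mnmP => j; rewrite !mnmDE !mulmnE !mnm1E /= expnS; lia.
apply: (leading_add all_vars4).
  by apply/leading_mulXn/IH.
have [->|ti'] := eqVneq t i.
  by rewrite addnn -mul2n -expnS gshift_pow2 mulr0; exact: below0.
have lt_it : (i < t)%N by lia.
apply: (leading_below (leading_mulXn iw3 (2 ^ t) (IH t _ lt_it))); first by lia.
case: t it ti ti' lt_it {IH} => // t it ti ti' lt_it.
have : (2 ^ i <= 2 ^ t)%N by rewrite leq_exp2l.
rewrite lex_lt4E !mnmDE !mulmnE !mnm1E /= !expnS; have := expn_gt0 2 t; lia.
Qed.

(** Homogeneity with [w_4] in degree 4, as far as the exponent of [w_4] is
concerned. *)
Lemma msupp_gshift m l : l \in msupp (gshift m) -> (4 * l iw4 + 3 <= m)%N /\ l iva = 0%N.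
Proof.
elim/ltn_ind: m l => m IH l; have [m3|] := ltnP m 3.
  by rewrite gshift_small // msupp0.
case: m IH => [|[|[|[|m]]]] // IH _.
  by rewrite gshift3 msupp1 inE => /eqP ->; rewrite !mnm0E.
have supp_mulX (i : 'I_4) k : (k < m.+4)%N -> i != iva -> l \in msupp ('X_i * gshift k) ->
    (4 * l iw4 + 3 <= k + 4 * (i == iw4))%N /\ l iva = 0%N.
  move=> km ia_neq /msuppM_le /allpairsP [[u v] /= []].
  rewrite msuppX inE => /eqP -> /(IH k km)[vz va] ->.
  by rewrite !mnmDE !mnm1E va (negbTE ia_neq); split; first lia.
have := gshiftS m; rewrite addn4 => ->.
move/msuppD_le; rewrite mem_cat => /orP[/msuppD_le|].
  by rewrite mem_cat => /orP[]/supp_mulX[]//=; lia.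
by move=> /supp_mulX[]//=; lia.
Qed.

(** In the recurrence for [gshift (2 ^ t + 3)] the last term is the pure power of
[w_4]; by degree, the exponents of [w_4] in the other terms are smaller. *)
Lemma leading_w4 t : (2 <= t)%N -> leading (gshift (2 ^ t + 3)) (U_(iw4) *+ 2 ^ (t - 2))%MM.
Proof.
case: t => [|[|t]] // _; rewrite !subSS subn0 gshift_pow2D gshift3 mulr1 addrC.
have q0 := expn_gt0 2 t.
apply: (leading_add all_vars4); first by rewrite mpolyXn; exact: leading_X.
have belowXh (i : 'I_4) k : (i < 2)%N -> (k <= 2 * 2 ^ t)%N ->
    below vars (U_(iw4) *+ 2 ^ t)%MM ('X_i ^+ (2 ^ t) * gshift (k + 3)).
  move=> i2 kq l /msuppM_le /allpairsP [[u v] /= []].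
  rewrite mpolyXn msuppX inE => /eqP -> /msupp_gshift[vz va] ->.
  rewrite lex_lt4E !mnmDE !mulmnE !mnm1E va /=.
  by case: i i2 => [[|[|[]]]] //= _ _; lia.
by apply: belowD; apply: belowXh => //; rewrite ?expnS; lia.
Qed.

Lemma msupp_mwiden (p : {mpoly 'F_2[3]}) l : l \in msupp (mwiden p) -> l iva = 0%N.
Proof.
rewrite (mwidenE (leqnn _)) => /msupp_sum_le /flattenP [s /mapP [m _ ->]].
by move=> /msuppZ_le; rewrite msuppX inE => /eqP ->; exact: mnmwiden_ordmax.
Qed.

Lemma leading_arel P Q : leading (arel P Q) (U_(iva) *+ 2)%MM.
Proof.
rewrite /arel -addrA; apply: (leading_add all_vars4).
  by rewrite /avar mpolyXn; exact: leading_X.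
apply: belowD => l.
  move=> /msuppM_le /allpairsP [[u v] /= [/msupp_mwiden ua]].
  rewrite msuppX inE => /eqP -> ->.
  by rewrite lex_lt4E !mulmnE !mnmDE !mnm1E ua /=.
by move=> /msupp_mwiden la; rewrite lex_lt4E !mulmnE !mnm1E la.
Qed.

(** For [i = t - 2] the last term is [gshift (2 ^ t.+1)], which is zero. *)
Lemma staircase_syzygy t i :
  'X_iw3 ^+ (2 ^ i) * gshift (2 ^ t + 2 ^ i) =
  'X_iw2 ^+ (2 ^ i) * gshift (2 ^ t + 2 ^ i.+1) + gshift (2 ^ t + 2 ^ i.+2).
Proof.
have -> : (2 ^ i.+2 = 4 * 2 ^ i)%N by rewrite !expnS; lia.
rewrite gshift_frobenius gshift_pow2 mulr0 addr0 expnS.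
by rewrite addrA addpp add0r.
Qed.

(** * The Groebner basis *)

Section Basis.
Variables (t : nat) (P Q : {mpoly 'F_2[3]}).
Hypothesis ht : (2 <= t)%N.

Let gens : seq R4 := [:: mwiden (gpoly (2 ^ t - 2)); mwiden (gpoly (2 ^ t - 1));
                   mwiden (gpoly (2 ^ t)); arel P Q].
Let G : seq R4 := [seq mwiden (gpoly (2 ^ t - 3 + 2 ^ k)) | k <- iota 0 t]
       ++ [:: mwiden (gpoly (2 ^ t)); arel P Q].

(* Makes the truncated subtractions in the indices below exact. *)
Let pow_t : (4 <= 2 ^ t)%N.
Proof. by rewrite -[4%N]/(2 ^ 2)%N leq_exp2l. Qed.

Let size_G : size G = t.+2.
Proof. by rewrite size_cat size_map size_iota addn2. Qed.

Let G_staircase j : (j < t)%N -> G`_j = gshift (2 ^ t + 2 ^ j).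
Proof.
move=> jt; rewrite nth_cat size_map size_iota jt (nth_map 0%N) ?size_iota //.
by rewrite nth_iota // add0n; apply: mwiden_gpoly; lia.
Qed.

Let G_w4 : G`_t = gshift (2 ^ t + 3).
Proof.
rewrite nth_cat size_map size_iota ltnn subnn /=.
exact: mwiden_gpoly.
Qed.

Let G_arel : G`_t.+1 = arel P Q.
Proof. by rewrite nth_cat size_map size_iota ltnNge leqnSn subSnn. Qed.

(** The terms of index [2^t], ..., [2^t + 3] are zero and the three given
polynomials, and the recurrence propagates membership. *)
Lemma ideal_gen_gshift m : ideal_gen gens (gshift (2 ^ t + m)).
Proof.
elim/ltn_ind: m => -[|[|[|[|m]]]] IH.
- by rewrite addn0 gshift_pow2; exact: ideal_gen0.
- rewrite -(@mwiden_gpoly (2 ^ t - 2)); last by lia.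
  exact: (@ideal_gen_nth _ _ gens 0).
- rewrite -(@mwiden_gpoly (2 ^ t - 1)); last by lia.
  exact: (@ideal_gen_nth _ _ gens 1).
- rewrite -(@mwiden_gpoly (2 ^ t)) //; exact: (@ideal_gen_nth _ _ gens 2).
have -> : (2 ^ t + m.+4 = 2 ^ t + m + 4)%N by lia.
rewrite gshiftS -!(addnA (2 ^ t)%N).
by do 2?apply: ideal_genD; apply/ideal_genM/IH; lia.
Qed.

Lemma ideal_gens_eq : ideal_gen gens = ideal_gen G.
Proof.
rewrite eqEsubset; split; apply: ideal_gen_sub => f.
  rewrite !inE => /or4P[] /eqP ->.
  - rewrite (@mwiden_gpoly _ (2 ^ t + 2 ^ 0)); last by lia.
    by rewrite -G_staircase ?(ltnW ht) //; apply: ideal_gen_nth; rewrite size_G.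
  - rewrite (@mwiden_gpoly _ (2 ^ t + 2 ^ 1)); last by lia.
    by rewrite -G_staircase //; apply: ideal_gen_nth; rewrite size_G.
  - rewrite (@mwiden_gpoly _ (2 ^ t + 3)) // -G_w4.
    by apply: ideal_gen_nth; rewrite size_G.
  - by rewrite -G_arel; apply: ideal_gen_nth; rewrite size_G.
case/(nthP 0) => j; rewrite size_G => jt <-.
have [jt'|tj] := ltnP j t; first by rewrite G_staircase //; exact: ideal_gen_gshift.
have [->|jnt] := eqVneq j t; first by rewrite G_w4; exact: ideal_gen_gshift.
have -> : j = t.+1 by lia.
by rewrite G_arel; exact: (@ideal_gen_nth _ _ gens 3).
Qed.

Let lm j : 'X_{1..4} :=
  if (j < t)%N then staircase t j
  else if j == t then (U_(iw4) *+ 2 ^ (t - 2))%MM else (U_(iva) *+ 2)%MM.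

Let mult j (m : 'X_{1..4}) : bool :=
  [&& (j <= t)%N ==> (m iva < 2)%N, (j < t)%N ==> (m iw4 < 2 ^ (t - 2))%N
    & (j.+1 < t)%N ==> (m iw3 < 2 ^ j)%N].

Let lm_w4 : lm t = (U_(iw4) *+ 2 ^ (t - 2))%MM.
Proof. by rewrite /lm ltnn eqxx. Qed.

Let lm_arel : lm t.+1 = (U_(iva) *+ 2)%MM.
Proof. by rewrite /lm ltnNge leqnSn gtn_eqF. Qed.

Lemma basis_leading j : (j < size G)%N -> leading G`_j (lm j).
Proof.
rewrite size_G /lm => jt2; case: ifP => [jt|/negbT].
  by rewrite G_staircase //; exact: leading_staircase.
rewrite -leqNgt => tj; case: eqP => [->|jnt]; first by rewrite G_w4; exact: leading_w4.
have -> : j = t.+1 by lia.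
by rewrite G_arel; exact: leading_arel.
Qed.

(** A generator whose leading monomial is a power of one variable has a cone that
avoids those of the previous generators, as their multipliers are not divisible
by this power and their leading monomials are free of the variable. The cones of
the staircase are separated by the exponent of [w_3]. *)
Lemma basis_disjoint (j k : nat) m l :
  (j < k < size G)%N -> mult j m -> mult k l -> (m + lm j)%MM != (l + lm k)%MM.
Proof.
rewrite size_G => /andP[jk kt] /and3P[/implyP ma /implyP mz /implyP my] _.
apply/eqP => /mnmP eq_ml.
have [kt1|kt1] := eqVneq k t.+1.
  have jt : (j <= t)%N by lia.
  have := eq_ml iva; have := ma jt.
  rewrite kt1 lm_arel /lm mnmDE [(l + _)%MM _]mnmDE mulmnE mnm1E eqxx.
  case: ifP => [_|/negbT tj]; first by rewrite mnmDE !mulmnE !mnm1E /=; lia.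
  by rewrite (_ : j == t) ?mulmnE ?mnm1E /=; lia.
have [ktt|ktt] := eqVneq k t.
  have jt : (j < t)%N by lia.
  have := eq_ml iw4; have := mz jt.
  rewrite ktt lm_w4 /lm jt /staircase !mnmDE !mulmnE !mnm1E /=; lia.
have := eq_ml iw3; have := my _; rewrite /lm (_ : j < t)%N 1?(_ : k < t)%N; try lia.
rewrite /staircase !mnmDE !mulmnE !mnm1E /=.
have : (2 ^ j.+1 <= 2 ^ k)%N by rewrite leq_exp2l.
have := expn_gt0 2 j; rewrite expnS; lia.
Qed.

Lemma basis_rewrites j m : (j < size G)%N -> ~~ mult j m -> rewrites vars G j m.
Proof.
rewrite size_G => jt2 nE.
have rew k : (j < k < t.+2)%N -> (lm k <= m)%MM -> rewrites vars G j m.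
  by rewrite -size_G; exact: (rewrites_leading all_vars4 basis_leading).
have lepU (i : 'I_4) k : (k <= m i)%N -> (U_(i) *+ k <= m)%MM.
  move=> km; apply/mnm_lepP => i'; rewrite mulmnE mnm1E.
  by case: eqP => [<-|_]; rewrite ?mul1n ?mul0n.
have [a2|a2] := leqP 2 (m iva).
  have [jt|tj] := leqP j t; last first.
    by move: nE; rewrite /mult; lia.
  by apply: (rew t.+1); rewrite ?lm_arel ?lepU //; lia.
have [jt|tj] := ltnP j t; last by move: nE; rewrite /mult; lia.
have [zq|zq] := leqP (2 ^ (t - 2)) (m iw4).
  by apply: (rew t); rewrite ?lm_w4 ?lepU //; lia.
have [jt1 yq] : (j.+1 < t)%N /\ (2 ^ j <= m iw3)%N by move: nE; rewrite /mult; lia.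
(* Only the exponent of w_3 remains too large: use the relation between steps. *)
set q := (2 ^ j)%N in yq; set l := (U_(iw3) *+ q)%MM.
pose d1 : R4 := 'X_[m - l] * 'X_iw2 ^+ q.
(* For j = t - 2 the relation has no third term, and G`_t is g_(2^t) instead. *)
pose d2 : R4 := if (j.+2 < t)%N then 'X_[m - l] else 0.
have d2E : d2 * G`_j.+2 = 'X_[m - l] * gshift (2 ^ t + 2 ^ j.+2).
  rewrite /d2; case: ifP => jt2'; first by rewrite G_staircase.
  have -> : t = j.+2 by lia.
  by rewrite addnn -mul2n -expnS gshift_pow2 mul0r mulr0.
have syz : 'X_[m] * G`_j = d1 * G`_j.+1 + d2 * G`_j.+2 :> R4.
  rewrite d2E (G_staircase jt) (G_staircase jt1) -{1}(submK (lepU _ _ yq)) mpolyXD.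
  by rewrite -mulrA -mpolyXn staircase_syzygy mulrDr mulrA.
exists (fun i => delta j.+1 d1 i + delta j.+2 d2 i); split.
- under [RHS]eq_bigr do rewrite mulrDl.
  rewrite big_split /= !sum_delta ?size_G; try lia.
  exact: syz.
- by move=> i ij; rewrite /delta !ltn_eqF ?addr0 //; lia.
- by rewrite /delta !ltn_eqF ?addr0 //; exact: below0.
Qed.

Lemma staircase_groebner : groebner_basis lex_w3_w2_w4_a (ideal_gen gens) G.
Proof.
rewrite ideal_gens_eq.
exact: (cones_groebner all_vars4 basis_leading basis_disjoint basis_rewrites).
Qed.
End Basis.

Theorem theorem4p4 (R : realType) (t : nat) (ht : (3 <= t)%N)
  (w : nat -> cohomology R (OGr R (2 ^ t) 4))
  (hw : stiefel_whitney (covering R (2 ^ t) 4) w)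
  (U : OGr R (2 ^ t) 3)
  (i : continuousType (usphere R (2 ^ t - 3)) (sphere_bundle R (2 ^ t) 3))
  (hi : fiber_inclusion U i)
  (c : cohomology R (sphere_bundle R (2 ^ t) 3))
  (hc : in_degree (2 ^ t - 4) c)
  (hic : is_generator (2 ^ t - 4) (pullback i c))
  (a : cohomology R (OGr R (2 ^ t) 4))
  (ha : in_degree (2 ^ t - 4) a)
  (hap : ~ range (pullback (R := R) (covering R (2 ^ t) 4)) a)
  (hac : pullback (sp R (2 ^ t) 3) a = c)
  (P Q : {mpoly 'F_2[3]})
  (hPQ : a ^+ 2 = peval (fun j : 'I_3 => w j.+2) P * a
                  + peval (fun j : 'I_3 => w j.+2) Q) :
  groebner_basis lex_w3_w2_w4_a
    (ideal_gen [:: mwiden (gpoly (2 ^ t - 2)); mwiden (gpoly (2 ^ t - 1));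
                   mwiden (gpoly (2 ^ t)); arel P Q])
    ([seq mwiden (gpoly (2 ^ t - 3 + 2 ^ k)) | k <- iota 0 t]
       ++ [:: mwiden (gpoly (2 ^ t)); arel P Q]).
Proof. by apply: staircase_groebner; exact: ltnW. Qed.
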